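(* Let $p$ be a prime, let $G$ be a finite group of $p$-power order, and let $\varphi\colon A\to B$ be an isomorphism between subgroups $A,B$ of $G$. Let $G^*=\langle G,t \mid t^{-1}at=\varphi(a),\ a\in A\rangle$ be the HNN extension. Suppose there exists a central filtration $(G_1,\dots,G_n)$ of $G$, compatible with $(G,\varphi)$, such that for every $i$ the order of the automorphism of the core $H(G_i/G_{i+1},\varphi_{i,i+1})$ induced by $\varphi_{i,i+1}$ is a power of $p$. Then $G^*$ is residually $p$, i.e. for every non-trivial $g\in G^*$ there is a homomorphism from $G^*$ to a finite $p$-group whose value at $g$ is non-trivial.
   Context: An HNN pair $(G,\varphi)$ consists of a group $G$ and an isomorphism $\varphi\colon A\to B$ between subgroups of $G$. A filtration of $G$ is a sequence $(G_1,\dots,G_n)$ of normal subgroups of $G$ with $G=G_1\supsetneq G_2\supsetneq\cdots\supsetneq G_n=\{1\}$; one sets $G_i=\{1\}$ for $i>n$. It is central if $G_i/G_{i+1}$ is central in $G/G_{i+1}$ for each $i$. The filtration is compatible with $(G,\varphi)$ if $\varphi$ restricts to an isomorphism $A\cap G_i\to B\cap G_i$ for each $i$. In that case, for $i<j$, $\varphi$ induces an isomorphism $\varphi_{ij}\colon (A\cap G_i)G_j/G_j\to (B\cap G_i)G_j/G_j$ between subgroups of $G_i/G_j$, so $(G_i/G_j,\varphi_{ij})$ is again an HNN pair. For an HNN pair $(Q,\psi\colon A'\to B')$, its core $H(Q,\psi)$ is defined by $H_0=A'\cap B'$, $H_{k+1}=\psi^{-1}(H_k)\cap H_k\cap\psi(H_k)$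 (where $\psi^{-1}(H_k)=\{a\in A':\psi(a)\in H_k\}$), and $H(Q,\psi)=\bigcap_k H_k$; $\psi$ restricts to an automorphism of $H(Q,\psi)$. *)

(* Defs.v *)
From HB Require Import structures.
From mathcomp Require Import all_boot all_order all_fingroup all_solvable.
From Stdlib Require Import Relations.
Set Implicit Arguments. Unset Strict Implicit. Unset Printing Implicit Defensive.
Import GroupScope.
Local Open Scope group_scope.

(* Elements of G* are represented by words in the letters g (g in G), t, t^-1,
   modulo the congruence generated by the defining relations of G* (together
   with the multiplication table of G and t t^-1 = t^-1 t = 1).  This is the
   monoid presentation of the group G*.                                       *)

Inductive hnn_letter (gT : finGroupType) :=
  | Lg of gT
  | Lt
  | Lti.
Arguments Lt {gT}.
Arguments Lti {gT}.

Definition hnn_word (gT : finGroupType) := seq (hnn_letter gT).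

Definition letter_in (gT : finGroupType) (G : {set gT}) (l : hnn_letter gT) : bool :=
  match l with Lg x => x \in G | _ => true end.

Inductive hnn_rule (gT : finGroupType) (G A : {set gT}) (phi : gT -> gT) :
    hnn_word gT -> hnn_word gT -> Prop :=
  | rule_mul x y : x \in G -> y \in G -> hnn_rule G A phi [:: Lg x; Lg y] [:: Lg (x * y)]
  | rule_one : hnn_rule G A phi [:: Lg 1] [::]
  | rule_tti : hnn_rule G A phi [:: Lt; Lti] [::]
  | rule_tit : hnn_rule G A phi [:: Lti; Lt] [::]
  | rule_conj a : a \in A -> hnn_rule G A phi [:: Lti; Lg a; Lt] [:: Lg (phi a)].

Definition hnn_step (gT : finGroupType) (G A : {set gT}) (phi : gT -> gT)
    (u v : hnn_word gT) : Prop :=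
  exists l r pre suf, [/\ hnn_rule G A phi l r, u = pre ++ l ++ suf & v = pre ++ r ++ suf].

Definition hnn_equiv (gT : finGroupType) (G A : {set gT}) (phi : gT -> gT) :
    relation (hnn_word gT) :=
  clos_refl_sym_trans _ (hnn_step G A phi).

Definition hnn_eval (gT rT : finGroupType) (f : gT -> rT) (t : rT) (w : hnn_word gT) : rT :=
  foldr (fun l acc => match l with Lg x => f x | Lt => t | Lti => t^-1 end * acc) 1 w.

(* G* is residually p: every non-trivial element of G* survives in some
   homomorphism G* -> P, P a finite p-group.  Homomorphisms G* -> P are exactly
   the pairs (f : G -> P morphism, t in P) with t^-1 f(a) t = f(phi a). *)
Definition hnn_residually_p (p : nat) (gT : finGroupType) (G A : {set gT})
    (phi : gT -> gT) : Prop :=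
  forall w : hnn_word gT, all (letter_in G) w -> ~ hnn_equiv G A phi w [::] ->
  exists (P : finGroupType) (f : {morphism G >-> P}) (t : P),
    [/\ p.-group [set: P],
        forall a, a \in A -> t^-1 * f a * t = f (phi a)
      & hnn_eval f t w != 1].

Fixpoint core_seq (qT : finGroupType) (A' B' : {set qT}) (psi : qT -> qT) (k : nat)
    : {set qT} :=
  match k with
  | 0 => A' :&: B'
  | k.+1 => let H := core_seq A' B' psi k in
            [set a in A' | psi a \in H] :&: H :&: (psi @: H)
  end.

Definition in_core (qT : finGroupType) (A' B' : {set qT}) (psi : qT -> qT) (x : qT) : Prop :=
  forall k, x \in core_seq A' B' psi k.

(* The map phi_{ij} : (A cap G_i)G_j/G_j -> (B cap G_i)G_j/G_j induced by phi,
   on cosets of G_j: C |-> coset of phi(x) for any x in C cap A cap G_i. *)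
Definition induced_phi (gT : finGroupType) (A : {set gT}) (phi : gT -> gT)
    (Gi Gj : {set gT}) (C : coset_of Gj) : coset_of Gj :=
  coset Gj (phi (repr ((C : {set gT}) :&: (A :&: Gi)))).
Arguments induced_phi {gT} A phi Gi Gj C.

(* Main.v *)
Require Import Defs.
From HB Require Import structures.
From mathcomp Require Import all_boot all_order all_fingroup all_solvable.
From mathcomp Require Import zmodp.
From Stdlib Require Import Relations.
Import GroupScope.
Local Open Scope group_scope.
Set Implicit Arguments.
Unset Strict Implicit.
Unset Printing Implicit Defensive.

(** It suffices to embed [G] in a finite p-group [P] containing some [t] with
    [t^-1 a t = phi a] on [A]: multiplying [t] by a function on [P / A] with values
    in a p-quotient of a free group then separates any given reduced word of [G*].

    The embedding is built one layer of the filtration at a time.  For a layer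
    [V = G_i / G_(i+1)], take [q = p^k] copies of [V] indexed by [Z/q] and identify
    each [a] in one copy with [phi a] in the neighbouring one; the shift induces [phi].
    An element [v] of [V] dies only if [v = a - phi^q a] for some [a] all of whose
    first [q] iterates are defined.  For [q > #|V|] such an [a] is periodic,
    hence lies in the core, so [phi^q a = a] and [v = 0] once [k] is large.
    If [G / G_i] embeds in [Q] and [V] in [W], compatibly with [phi], then
    [G / G_(i+1)] embeds in the wreath product of [W] by [Q] (Kaloujnine-Krasner);
    the equation that the [Q -> W] component of [t] must satisfy can be solved on each
    left coset of [A] because [V] is central. *)

(** * Wreath products as permutation groups *)

Section Wreath.
Variables W Q : finGroupType.
Implicit Types (d e : Q -> W) (s t : Q) (V : {group W}) (K : {group Q}).

(** A wreath product element acts on [W * Q] by right translations, with a [W]-part depending on the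
    position in [Q]. As permutations these elements get the group laws from [perm], and [d] can stay
    an ordinary function. *)
Definition wr_fun d s (u : W * Q) : W * Q := (u.1 * d u.2, u.2 * s).

Lemma wr_fun_inj d s : injective (wr_fun d s).
Proof.
move=> [r q] [r' q'] [/= Er Eq]; have E : q = q' by apply: mulIg Eq.
by move: Er; rewrite E => /mulIg ->.
Qed.

Definition wrp d s : {perm W * Q} := perm (@wr_fun_inj d s).

Lemma wrpE d s r q : wrp d s (r, q) = (r * d q, q * s).
Proof. by rewrite permE. Qed.

Lemma eq_wrp d e s : d =1 e -> wrp d s = wrp e s.
Proof. by move=> de; apply/permP=> -[r q]; rewrite !wrpE de. Qed.

Lemma wrp_inj d e s t : wrp d s = wrp e t -> s = t /\ d =1 e.
Proof.
move=> E; split=> [|q].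
  by have := congr1 (fun u : {perm W * Q} => (u (1, 1)).2) E; rewrite !wrpE /= !mul1g.
by have := congr1 (fun u : {perm W * Q} => (u (1, q)).1) E; rewrite !wrpE /= !mul1g.
Qed.

Lemma wrp1 : wrp (fun=> 1) 1 = 1.
Proof. by apply/permP=> -[r q]; rewrite wrpE perm1 !mulg1. Qed.

Lemma wrpM d s e t : wrp d s * wrp e t = wrp (fun q => d q * e (q * s)) (s * t).
Proof. by apply/permP=> -[r q]; rewrite permM !wrpE !mulgA. Qed.

Lemma wrpV d s : (wrp d s)^-1 = wrp (fun q => (d (q * s^-1))^-1) s^-1.
Proof.
apply/eqP; rewrite eq_invg_mul wrpM mulgV -wrp1; apply/eqP/eq_wrp => q.
by rewrite mulgK mulgV.
Qed.

Lemma wrpX d n : wrp d 1 ^+ n = wrp (fun q => d q ^+ n) 1.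
Proof.
elim: n => [|n IH]; first by rewrite expg0 -wrp1; apply: eq_wrp.
by rewrite expgS IH wrpM mulg1; apply: eq_wrp => q; rewrite mulg1 expgS.
Qed.

Definition wreath (V : {set W}) (K : {set Q}) : {set {perm W * Q}} :=
  [set x | [exists d : {ffun Q -> W}, exists s : Q,
     [&& [forall q, d q \in V], s \in K & x == wrp d s]]].

Lemma wreathP (V : {set W}) (K : {set Q}) x :
  reflect (exists d s, [/\ forall q, d q \in V, s \in K & x = wrp d s])
          (x \in wreath V K).
Proof.
rewrite inE; apply: (iffP existsP) => [[d /existsP[s /and3P[/forallP dV sK /eqP->]]]|].
  by exists d, s.
move=> [d [s [dV sK ->]]]; exists [ffun q => d q]; apply/existsP; exists s.
apply/and3P; split=> //; first by apply/forallP=> q; rewrite ffunE.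
by apply/eqP/eq_wrp=> q; rewrite ffunE.
Qed.

Lemma wrp_wreath (V : {set W}) (K : {set Q}) d s :
  (forall q, d q \in V) -> s \in K -> wrp d s \in wreath V K.
Proof. by move=> dV sK; apply/wreathP; exists d, s. Qed.

Lemma wreath_group_set V K : group_set (wreath V K).
Proof.
apply/group_setP; split; first by rewrite -wrp1 wrp_wreath.
move=> _ _ /wreathP[d [s [dV sK ->]]] /wreathP[e [t [eV tK ->]]].
by rewrite wrpM wrp_wreath ?groupM // => q; rewrite groupM.
Qed.
Canonical wreath_group V K := Group (wreath_group_set V K).

Lemma wrpX_exists V d s n : (forall q, d q \in V) ->
  exists2 e, (forall q, e q \in V) & wrp d s ^+ n = wrp e (s ^+ n).
Proof.
move=> dV; elim: n => [|n [e eV IH]]; first by exists (fun=> 1); rewrite ?wrp1.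
by eexists; last (by rewrite expgS IH wrpM expgS); move=> q; rewrite groupM.
Qed.

(** By Cauchy it suffices to bound element orders: the [#|K|]-th power of an element has trivial
    [Q]-part, so it is a function into [V], and its [#|V|]-th power is trivial. *)
Lemma wreath_pgroup p V K : p.-group V -> p.-group K -> p.-group (wreath V K).
Proof.
move=> pV pK; apply/pgroupP=> r r_pr /(Cauchy r_pr)[x xWr ox].
have pVK : p.-nat (#|K| * #|V|)%N by rewrite pnatM; apply/andP.
apply: (pnatPpi pVK); rewrite mem_primes r_pr muln_gt0 !cardG_gt0 /= -ox order_dvdn.
case/wreathP: xWr => d [s [dV sK ->]].
have [e eV E] := wrpX_exists s #|K| dV.
rewrite expgM E expg_cardG // wrpX -wrp1; apply/eqP/eq_wrp=> q.
exact: expg_cardG.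
Qed.

End Wreath.

(** * Lifting along a central layer *)

(** An embedding of [G / N] in a finite p-group in which some [t] induces [phi]. Only the subgroup
    [K] is required to be a p-group, so that wreath products and quotients fit without changing
    types. *)
Definition p_realizable p (gT : finGroupType) (G A : {group gT}) (phi : gT -> gT)
    (N : {set gT}) : Prop :=
  exists (P : finGroupType) (K : {group P}) (f : {morphism G >-> P}) (t : P),
    [/\ p.-group K, f @* G \subset K, t \in K, 'ker f = N
      & forall a, a \in A -> f a * t = t * f (phi a)].

Section CentralStep.
Variables (gT Q W : finGroupType) (G A M N : {group gT}).
Variables (phi : {morphism A >-> gT}).
Variables (f : {morphism G >-> Q}) (s : Q) (w : {morphism M >-> W}) (sg : W).
Hypotheses (sAG : A \subset G) (phiG : phi @* A \subset G).
Hypotheses (kerf : 'ker f = M) (kerw : 'ker w = N).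
Hypothesis fs : forall a, a \in A -> f a * s = s * f (phi a).
Hypothesis wsg : forall a, a \in A :&: M -> w a * sg = sg * w (phi a).
Hypothesis cGM : [~: G, M] \subset N.

Let sMG : M \subset G. Proof. by rewrite -kerf subsetIl. Qed.
Let AG a : a \in A -> a \in G. Proof. exact: (subsetP sAG). Qed.
Let MG x : x \in M -> x \in G. Proof. exact: (subsetP sMG). Qed.
Let pG a : a \in A -> phi a \in G.
Proof. by move=> aA; apply: (subsetP phiG); rewrite mem_morphim. Qed.

Let inM x y : x \in G -> y \in G -> f x = f y -> x * y^-1 \in M.
Proof.
move=> xG yG E; rewrite -kerf; apply/kerP; rewrite ?groupM ?groupV //.
by rewrite morphM ?groupV // morphV // E mulgV.
Qed.

Let phiM a : a \in A :&: M -> phi a \in M.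
Proof.
case/setIP=> aA aM; rewrite -kerf; apply/kerP; first exact: pG.
have fa1 : f a = 1 by apply: mker; rewrite kerf.
by have := fs aA; rewrite fa1 mul1g -{1}[s]mulg1 => /mulgI.
Qed.

(** Conjugation by [x] changes [z] by an element of [[~: G, M]], which [w] kills. This is where the
    centrality of the layer enters. *)
Let w_conj x z : x \in G -> z \in M -> w (x * z * x^-1) = w z.
Proof.
move=> xG zM; have yM : x * z * x^-1 \in M.
  rewrite -kerf -mulgA -{1}[x]invgK -conjgE memJ_norm ?kerf //.
  by rewrite -kerf (subsetP (ker_norm f)) ?groupV.
have : (x * z * x^-1) * z^-1 \in 'ker w.
  rewrite kerw; apply: (subsetP cGM).
  have -> : x * z * x^-1 * z^-1 = [~ x^-1, z^-1].
    by rewrite /commg /conjg !invgK !mulgA.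
  by rewrite mem_commg ?groupV.
move/mker; rewrite morphM ?groupV // morphV // => E.
by apply/eqP; rewrite eq_mulgV1 E.
Qed.

(* [tau H q] lifts the position of [q] in its left coset of [f @* H]. *)
Let base (H : {set gT}) q := repr (q *: (f @* H)).
Let tau (H : {set gT}) q := repr [set h in H | f h == (base H q)^-1 * q].

Let tauP (H : {group gT}) q : H \subset G -> tau H q \in H /\ base H q * f (tau H q) = q.
Proof.
move=> sHG; have : base H q \in q *: (f @* H) by apply: (mem_repr q); apply: lcoset_refl.
case/lcosetP=> _ /morphimP[h hG hH ->] Eb.
have : tau H q \in [set h in H | f h == (base H q)^-1 * q].
  apply: (mem_repr h^-1); rewrite inE groupV hH morphV //= Eb invMg mulgKV //.
by rewrite inE => /andP[-> /eqP->]; rewrite mulKVg.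
Qed.

Let base_mul (H : {group gT}) q h : H \subset G -> h \in H -> base H (q * f h) = base H q.
Proof.
move=> sHG hH; rewrite /base; congr repr; rewrite lcosetM; congr (_ *: _).
by apply: lcoset_id; rewrite mem_morphim // (subsetP sHG).
Qed.

(** The Kaloujnine-Krasner cocycle. Its argument lies in [M] because [f] takes equal values on both
    sides of the quotient; the cocycle identity [cM] is what makes [F] below a morphism. *)
Let c g q := w (tau G q * g * (tau G (q * f g))^-1).

Let tauG q : tau G q \in G. Proof. by case: (tauP q (subxx G)). Qed.

Let c_arg g q : g \in G -> tau G q * g * (tau G (q * f g))^-1 \in M.
Proof.
move=> gG; apply: inM; rewrite ?groupM // morphM //.
have [_ E1] := tauP q (subxx G); have [_ E2] := tauP (q * f g) (subxx G).
by apply: (mulgI (base G q)); rewrite mulgA E1 -[LHS]E2 base_mul.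
Qed.

Let cM g h q : g \in G -> h \in G -> c (g * h) q = c g q * c h (q * f g).
Proof.
move=> gG hG; rewrite /c -morphM ?c_arg // (morphM f) // mulgA; congr (w _).
by rewrite !mulgA mulgKV.
Qed.

Let c_ker z q : z \in M -> c z q = w z.
Proof.
move=> zM; have fz : f z = 1 by apply: mker; rewrite kerf.
by rewrite /c fz mulg1 w_conj.
Qed.

Let d q := (c (tau A q) (base A q))^-1 * sg * c (phi (tau A q)) (base A q * s).

(** The lift [v] of [q * f a] and the product [u * a] differ by some [z] in [A :&: M]. This [z]
    contributes [w z] on one side of [sg] and [w (phi z)] on the other, and [wsg] makes them
    cancel. *)
Let dE q a : a \in A -> c a q * d (q * f a) = d q * c (phi a) (q * s).
Proof.
move=> aA; rewrite /d base_mul //; set b := base A q.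
have [uA Eu] := tauP q sAG; have [vA Ev] := tauP (q * f a) sAG.
move: Ev vA; rewrite base_mul //; move: Eu uA.
rewrite -/b; set u := tau A q; set v := tau A _ => Eu uA Ev vA.
have vM : v * (u * a)^-1 \in M.
  apply: inM; rewrite ?AG ?groupM // morphM ?AG //.
  by apply: (mulgI b); rewrite Ev mulgA Eu.
have zA : v * (u * a)^-1 \in A by rewrite groupM ?groupV ?groupM.
move: vM zA; set z := v * _ => zM zA.
have zAM : z \in A :&: M by apply/setIP.
have -> : v = z * (u * a) by rewrite mulgKV.
clearbody z.
have fz : f z = 1 by apply: mker; rewrite kerf.
have fpz : f (phi z) = 1 by apply: mker; rewrite kerf phiM.
have E1 : c (z * (u * a)) b = w z * c u b * c a q.
  by rewrite cM ?groupM ?AG // c_ker // fz mulg1 cM ?AG // Eu mulgA.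
have E2 : c (phi (z * (u * a))) (b * s)
        = w (phi z) * c (phi u) (b * s) * c (phi a) (q * s).
  rewrite !morphM ?groupM // cM ?groupM ?pG // c_ker ?phiM // fpz mulg1.
  by rewrite cM ?pG // -[b * s * _]mulgA -fs // [b * (_ * _)]mulgA Eu mulgA.
have Ez := wsg zAM.
rewrite E1 E2 !invMg !mulgA mulgV mul1g; congr (_ * _ * _).
by rewrite -!mulgA; congr (_ * _); rewrite -[RHS](mulKg (w z)) [_ * (sg * _)]mulgA Ez !mulgA.
Qed.

Let F g := wrp (c g) (f g).

Let FM : {in G &, {morph F : x y / x * y}}.
Proof. by move=> x y xG yG; rewrite /F wrpM morphM //; apply: eq_wrp => q; apply: cM. Qed.

Lemma central_step (KQ : {group Q}) (KW : {group W}) :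
  f @* G \subset KQ -> s \in KQ -> w @* M \subset KW -> sg \in KW ->
  exists (F : {morphism G >-> {perm W * Q}}) t,
    [/\ F @* G \subset wreath KW KQ, t \in wreath KW KQ, 'ker F = N
      & forall a, a \in A -> F a * t = t * F (phi a)].
Proof.
move=> fK sK wK sgK.
have cK g q : g \in G -> c g q \in KW.
  by move=> gG; apply: (subsetP wK); rewrite mem_morphim ?c_arg.
exists (Morphism FM), (wrp d s); split.
- apply/subsetP=> _ /morphimP[g _ gG ->]; apply: wrp_wreath => [q|]; first exact: cK.
  by apply: (subsetP fK); rewrite mem_morphim.
- apply: wrp_wreath sK => q; have [uA _] := tauP q sAG.
  by rewrite !groupM ?groupV ?cK ?pG ?AG.
- apply/setP=> x; rewrite -kerw; apply/idP/idP.
    move=> xk; have xG := dom_ker xk.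
    have := mker xk; rewrite /= /F -wrp1 => /wrp_inj[fx cx].
    have xM : x \in M by rewrite -kerf; apply/kerP.
    by apply/kerP; rewrite // -(c_ker 1).
  move=> xk; have [xM wx] := (dom_ker xk, mker xk); apply/kerP; first exact: MG.
  have fx : f x = 1 by apply: mker; rewrite kerf.
  by rewrite /= /F fx -wrp1; apply: eq_wrp => q; rewrite c_ker.
- move=> a aA; rewrite /= /F !wrpM fs //; apply: eq_wrp => q; exact: dE.
Qed.

End CentralStep.

Lemma p_realizable_step p (gT : finGroupType) (G A M N : {group gT})
    (phi : {morphism A >-> gT}) :
  A \subset G -> phi @* A \subset G -> [~: G, M] \subset N ->
  p_realizable p G A phi M -> p_realizable p M (A :&: M) phi N ->
  p_realizable p G A phi N.
Proof.
move=> sAG pAG cGM [Q [KQ [f [s [pQ fK sK kf fs]]]]] [W [KW [w [sg [pW wK sgK kw wsg]]]]].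
have [F [t [FK tK kF Ft]]] := central_step sAG pAG kf kw fs wsg cGM fK sK wK sgK.
exists _, (wreath KW KQ)%G, F, t; split=> //; exact: wreath_pgroup.
Qed.

(** * A single layer *)

(** Pigeonhole gives two equal iterates, and injectivity on [S] cancels their common initial
    steps. *)
Lemma iter_periodic (T : finType) (psi : T -> T) (S : {set T}) x m :
  {in S &, injective psi} -> (#|T| < m)%N ->
  (forall j, (j < m)%N -> iter j psi x \in S) ->
  exists2 r, (0 < r <= m)%N & iter r psi x = x.
Proof.
move=> inj_psi ltTm xS.
have : ~~ injectiveb (fun j : 'I_m => iter j psi x).
  apply/negP=> /injectiveP/leq_card; rewrite card_ord leqNgt; exact/negP/negPn.
case/injectivePn => i0 [j0 neq_ij Eij].
wlog ltij : i0 j0 neq_ij Eij / (i0 < j0)%N => [WL|].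
  case: (ltngtP i0 j0) => [|lt|/ord_inj E]; first exact: WL.
    by apply: (WL j0 i0) => //; rewrite eq_sym.
  by rewrite E eqxx in neq_ij.
exists (j0 - i0)%N; first by rewrite subn_gt0 ltij (leq_trans (leq_subr _ _)) // ltnW.
move: (ltn_ord j0) Eij; rewrite -{1 2}(subnK (ltnW ltij)).
move: (j0 - i0)%N => r; elim: (nat_of_ord i0) => [|i IH]; first by rewrite addn0 => _ /esym.
rewrite addnS /= => ltm /inj_psi E; apply: IH; first exact: ltnW.
by apply: E; apply: xS; [apply: leq_ltn_trans ltm; rewrite leqW ?leq_addl | apply: ltnW].
Qed.

(** A periodic orbit inside [A'] is closed under [psi] and under taking predecessors, so the whole
    orbit stays in every [core_seq]. The induction must treat all its points together. *)
Lemma mem_core_periodic (qT : finGroupType) (A' : {set qT}) (psi : qT -> qT) x m :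
  {in A' &, injective psi} -> (#|qT| < m)%N ->
  (forall j, (j < m)%N -> iter j psi x \in A') ->
  in_core A' (psi @: A') psi x.
Proof.
move=> inj_psi ltTm xA; have [r /andP[r_gt0 le_rm] Er] := iter_periodic inj_psi ltTm xA.
have xAll j : iter j psi x \in A'.
  rewrite (divn_eq j r) addnC iterD iterM (iter_fix _ Er); apply: xA.
  exact: leq_trans (ltn_pmod _ _) le_rm.
have xB j : exists2 i, iter i psi x \in A' & iter j psi x = psi (iter i psi x).
  (* By periodicity, iterate [j + r.-1] precedes iterate [j], even for [j = 0]. *)
  exists (j + r.-1)%N => //.
  by rewrite -iterS -addnS prednK // iterD Er.
suffices H k : forall j, iter j psi x \in core_seq A' (psi @: A') psi k.
  by move=> k; apply: (H k 0).
elim: k => [|k IH] j /=.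
  by rewrite inE xAll; have [i iA ->] := xB j; rewrite imset_f.
rewrite !inE xAll -iterS !IH /=; have [i _ ->] := xB j; exact: imset_f.
Qed.

Section Layer.
Variables (gT Q : finGroupType) (A B M N : {group gT}) (phi : {morphism A >-> gT}) (z : Q).
Hypotheses (injphi : 'injm phi) (sNM : N \subset M) (nNM : M \subset 'N(N)).
Hypothesis abMN : abelian (M / N).
Hypotheses (phiM : phi @* (A :&: M) = B :&: M) (phiN : phi @* (A :&: N) = B :&: N).

Let psi := induced_phi A phi M N.
Local Notation pr := (coset N).

Let phi_in (H : {group gT}) a :
  phi @* (A :&: H) = B :&: H -> a \in A :&: H -> phi a \in B :&: H.
Proof. by move=> <- aAH; rewrite mem_morphim //; case/setIP: aAH. Qed.

Let AM_A a : a \in A :&: M -> a \in A. Proof. by case/setIP. Qed.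
Let AM_M a : a \in A :&: M -> a \in M. Proof. by case/setIP. Qed.
Let phi_M a : a \in A :&: M -> phi a \in M. Proof. by move/(phi_in phiM)/setIP=> []. Qed.

Let prM x y : x \in M -> y \in M -> pr (x * y) = pr x * pr y.
Proof. by move=> xM yM; apply: morphM; apply: (subsetP nNM). Qed.
Let prV x : x \in M -> pr x^-1 = (pr x)^-1.
Proof. by move=> xM; apply: morphV; apply: (subsetP nNM). Qed.
Let pr_eq1 x : x \in M -> (pr x == 1) = (x \in N).
Proof.
move=> xM; apply/eqP/idP => [/coset_idr->//|]; first exact: (subsetP nNM).
exact: coset_id.
Qed.
Let prC x y : x \in M -> y \in M -> commute (pr x) (pr y).
Proof. by move=> xM yM; apply: (centsP abMN); apply: mem_quotient. Qed.

(** The choice made by [repr] is harmless: two representatives differ by an element of [A :&: N],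
    which [phi] sends into [N]. *)
Lemma induced_phiE a : a \in A :&: M -> psi (coset N a) = coset N (phi a).
Proof.
move=> aAM; rewrite /psi /induced_phi; set b := repr _.
have : b \in (coset N a : {set gT}) :&: (A :&: M).
  apply: (mem_repr a); rewrite inE aAM andbT val_coset ?rcoset_refl //.
  exact: (subsetP nNM _ (AM_M aAM)).
rewrite inE val_coset ?(subsetP nNM _ (AM_M aAM)) // mem_rcoset => /andP[baN bAM].
have naA : b * a^-1 \in A :&: N by rewrite inE baN andbT groupM ?groupV ?AM_A.
have -> : b = (b * a^-1) * a by rewrite mulgKV.
case/setIP: (phi_in phiN naA) => _ pN; rewrite morphM ?groupM ?groupV ?AM_A //.
by rewrite (prM (subsetP sNM _ pN) (phi_M aAM)) (coset_id pN) mul1g.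
Qed.

Let mem_quo y : y \in (A :&: M) / N -> exists2 a, a \in A :&: M & y = pr a.
Proof. by case/morphimP=> a _ aAM ->; exists a. Qed.

Lemma induced_phi_inj : {in (A :&: M) / N &, injective psi}.
Proof.
move=> _ _ /mem_quo[a aAM ->] /mem_quo[b bAM ->].
rewrite !induced_phiE // => E; have aM := AM_M aAM; have bM := AM_M bAM.
have abAM : a * b^-1 \in A :&: M by rewrite groupM ?groupV.
apply/eqP; rewrite eq_mulgV1 -prV // -prM ?groupV // (pr_eq1 (AM_M abAM)).
have : phi (a * b^-1) \in B :&: N.
  have /setIP[pB _] := phi_in phiM abAM.
  rewrite inE pB -pr_eq1 ?phi_M // morphM ?groupV ?AM_A // morphV ?AM_A //.
  by rewrite prM ?groupV ?phi_M // prV ?phi_M // E mulgV eqxx.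
rewrite -phiN => /morphimP[c cA /setIP[_ cN] Ec].
by rewrite (injmP injphi _ _ (AM_A abAM) cA Ec).
Qed.

Lemma induced_phi_imset : psi @: ((A :&: M) / N) = (B :&: M) / N.
Proof.
apply/setP=> y; apply/imsetP/idP => [[_ /mem_quo[a aAM ->] ->]|].
  by rewrite induced_phiE // mem_quotient // phi_in.
rewrite -phiM => /morphimP[_ _ /morphimP[a aA aAM ->] ->].
by exists (pr a); rewrite ?mem_quotient // induced_phiE.
Qed.

(* The relations identifying [a] in one copy of [M / N] with [phi a] in the
   previous copy, inside the wreath product of [M] by [<[z]>]. *)
Definition layer_rel : {set {perm gT * Q}} :=
  [set y | [exists d : {ffun Q -> gT}, exists a : {ffun Q -> gT},
    [&& [forall c, d c \in M], [forall c, a c \in A :&: M],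
        [forall c, coset N (d c) == coset N (a c) * (coset N (phi (a (c * z))))^-1]
      & y == wrp d 1]]].

Lemma layer_relP y : reflect
  (exists d a, [/\ forall c, d c \in M, forall c, a c \in A :&: M,
     forall c, coset N (d c) = coset N (a c) * (coset N (phi (a (c * z))))^-1
     & y = wrp d 1]) (y \in layer_rel).
Proof.
rewrite inE; apply: (iffP existsP) => [[d /existsP[a]]|[d [a [dM aAM da ->]]]].
  case/and4P=> /forallP dM /forallP aAM /forallP da /eqP->.
  by exists d, a; split=> // c; apply/eqP.
exists [ffun c => d c]; apply/existsP; exists [ffun c => a c].
apply/and4P; split; try (apply/forallP => c; rewrite !ffunE //); first exact/eqP.
by apply/eqP/eq_wrp => c; rewrite ffunE.
Qed.

Lemma layer_rel_group_set : group_set layer_rel.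
Proof.
apply/group_setP; split.
  apply/layer_relP; exists (fun=> 1), (fun=> 1); split=> //; last by rewrite wrp1.
  by move=> c; rewrite !morph1 mulgV.
move=> _ _ /layer_relP[d [a [dM aAM da ->]]] /layer_relP[e [b [eM bAM eb ->]]].
apply/layer_relP; exists (fun c => d c * e c), (fun c => a c * b c); split.
- by move=> c; rewrite groupM.
- by move=> c; rewrite groupM.
- move=> c; rewrite (morphM phi) ?AM_A // prM // da eb.
  rewrite (prM (AM_M (aAM c)) (AM_M (bAM c))) prM ?phi_M //.
  rewrite invMg -!mulgA; congr (_ * _); rewrite !mulgA.
  rewrite -(prV (phi_M (aAM _))) -(prV (phi_M (bAM _))).
  rewrite (prC (y := b c)) ?groupV ?phi_M ?AM_M // -!mulgA; congr (_ * _).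
  by apply: prC; rewrite groupV phi_M.
- by rewrite wrpM mulg1; apply: eq_wrp=> c; rewrite mulg1.
Qed.
Canonical layer_rel_group := Group layer_rel_group_set.

(** Conjugation by the function part is invisible modulo [N] since [M / N] is abelian, and a shift
    by a power of [z] translates [d] and [a] together. *)
Lemma wreath_norm_layer_rel : wreath M <[z]> \subset 'N(layer_rel).
Proof.
apply/subsetP=> _ /wreathP[e [s [eM sz ->]]]; rewrite inE; apply/subsetP=> _ /imsetP[y yD ->].
case/layer_relP: yD => d [a [dM aAM da ->]]; apply/layer_relP.
exists (fun c => d (c * s^-1) ^ e (c * s^-1)), (fun c => a (c * s^-1)); split=> //.
- by move=> c; rewrite groupJ.
- move=> c; have /cycleP[i ->] := sz.
  have -> : c * z * (z ^+ i)^-1 = c * (z ^+ i)^-1 * z.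
    by rewrite -!mulgA; congr (_ * _); apply: commuteV; apply: commuteX.
  rewrite -da /conjg !prM ?groupM ?groupV // prV //.
  by rewrite (prC (dM _) (eM _)) mulKg.
- rewrite /conjg wrpV !wrpM !mul1g mulVg; apply: eq_wrp => c.
  by rewrite mulg1 /conjg mulgA.
Qed.

(** [iota] places [x] in the copy at index 1; conjugation by [T] moves this copy to index [z]. *)
Let iota (x : gT) := wrp (fun c : Q => if c == 1 then x else 1) 1.
Let T : {perm gT * Q} := wrp (fun=> 1) z.

Let iotaK x : x \in M -> iota x \in wreath M <[z]>.
Proof. by move=> xM; apply: wrp_wreath => // q; case: ifP. Qed.
Let TK : T \in wreath M <[z]>. Proof. by apply: wrp_wreath (cycle_id z). Qed.
Let inND x : x \in wreath M <[z]> -> x \in 'N(layer_rel).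
Proof. exact: (subsetP wreath_norm_layer_rel). Qed.

Let layer_map x := coset layer_rel (iota x).

Let layer_mapM : {in M &, {morph layer_map : x y / x * y}}.
Proof.
move=> x y xM yM; rewrite /layer_map -morphM ?inND ?iotaK //; congr (coset _ _).
by rewrite /iota wrpM mulg1; apply: eq_wrp=> c; rewrite mulg1; case: eqP; rewrite ?mulg1.
Qed.

Lemma layer_map_rel a : a \in A :&: M ->
  layer_map a * coset layer_rel T = coset layer_rel T * layer_map (phi a).
Proof.
move=> aAM; have aM := AM_M aAM; have paM := phi_M aAM.
have E : coset layer_rel (T^-1 * iota a * T) = layer_map (phi a).
  apply/rcoset_kercosetP; rewrite ?inND ?groupM ?groupV ?iotaK ?TK //.
  rewrite mem_rcoset; apply/layer_relP.
  (* The conjugate of [iota a] is [a] at index [z]. Dividing by [iota (phi a)] gives exactly the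
     relation attached to the function with the single entry [a] at [z]. *)
  exists (fun c => (if c == z then a else 1) * (if c == 1 then phi a else 1)^-1).
  exists (fun c => if c == z then a else 1); split.
  - by move=> c; rewrite groupM ?groupV //; case: ifP.
  - by move=> c; case: ifP; rewrite ?group1.
  - move=> c; rewrite (eq_mulgV1 (c * z)) mulgK prM ?groupV; try by case: ifP.
    rewrite prV; last by case: ifP.
    by case: (c == 1); rewrite ?morph1.
  - rewrite /T /iota !wrpV !wrpM invg1 !mulg1 mulVg mulgV; apply: eq_wrp=> c.
    by rewrite invg1 !mulg1 mul1g -eq_mulgV1.
rewrite -E /layer_map !morphM ?groupM ?groupV ?inND ?iotaK ?TK //.
by rewrite morphV ?inND ?TK // !mulgA mulgV mul1g.
Qed.

Lemma layer_map_ker (p k e : nat) : #[z] = (p ^ k)%N -> (e <= k)%N ->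
  (#|{: coset_of N}| < p ^ k)%N ->
  (forall x, in_core ((A :&: M) / N) ((B :&: M) / N) psi x -> iter (p ^ e) psi x = x) ->
  forall x, x \in M -> layer_map x = 1 -> x \in N.
Proof.
move=> oz le_ek lt_card core_fix v vM /coset_idr.
move/(_ (inND (iotaK vM)))/layer_relP=> [d [a [_ aAM da]]].
move=> /wrp_inj[_ Ed].
have aS c : c != 1 -> pr (a c) = psi (pr (a (c * z))).
  move=> c1; have := da c; rewrite -Ed (negPf c1) morph1 induced_phiE //.
  by move/esym/eqP; rewrite -eq_mulgV1 => /eqP.
(* Away from index 1 the relation says that each entry is [psi] of the entry one step of [z]
   further. Going back from index 1 the chain lasts until the cycle closes, hence the bound on
   [j]. *)
have xE j : (j < p ^ k)%N -> pr (a (z ^- j)) = iter j psi (pr (a 1)).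
  elim: j => [|j IH] ltj; first by rewrite invg1.
  rewrite /= -IH ?(ltnW ltj) // aS; first by rewrite expgS invMg mulgKV.
  rewrite -eq_invg1 invgK -order_dvdn oz; apply/negP=> dv.
  by have := dvdn_leq (ltn0Sn j) dv; rewrite leqNgt ltj.
have q_gt0 : (0 < p ^ k)%N by apply: leq_trans lt_card.
(* Index [z] carries the last entry of the chain, so the relation at index 1 involves the [p ^ k]-th
   iterate of the entry at 1. *)
have zq : z = z ^- (p ^ k).-1.
  apply/eqP; rewrite eq_sym eq_invg_mul -expgSr prednK //.
  by rewrite -oz expg_order.
have xA j : (j < p ^ k)%N -> iter j psi (pr (a 1)) \in (A :&: M) / N.
  by move=> ltj; rewrite -xE // mem_quotient.
have xcore : in_core ((A :&: M) / N) ((B :&: M) / N) psi (pr (a 1)).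
  by rewrite -induced_phi_imset; apply: mem_core_periodic lt_card xA; apply: induced_phi_inj.
have xfix : iter (p ^ k) psi (pr (a 1)) = pr (a 1).
  by rewrite -(subnK le_ek) expnD iterM iter_fix // core_fix.
have := da 1; rewrite -Ed eqxx mul1g -induced_phiE // zq xE ?prednK //.
rewrite -iterS prednK // xfix mulgV => /eqP; by rewrite pr_eq1.
Qed.

Lemma layer_realizable (p k e : nat) : p.-group M -> #[z] = (p ^ k)%N -> prime p -> (e <= k)%N ->
  (#|{: coset_of N}| < p ^ k)%N ->
  (forall x, in_core ((A :&: M) / N) ((B :&: M) / N) psi x -> iter (p ^ e) psi x = x) ->
  p_realizable p M (A :&: M)%G phi N.
Proof.
move=> pM oz p_pr le_ek lt_card core_fix.
exists _, (wreath M <[z]> / layer_rel)%G, (Morphism layer_mapM), (coset layer_rel T); split.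
- by rewrite quotient_pgroup // wreath_pgroup // /pgroup -orderE oz pnatX pnat_id.
- by apply/subsetP=> _ /morphimP[x _ xM ->]; rewrite mem_quotient ?iotaK.
- by rewrite mem_quotient ?TK.
- apply/setP=> x; apply/idP/idP=> [xk|xN].
    exact: (layer_map_ker oz le_ek lt_card core_fix (dom_ker xk) (mker xk)).
  apply/kerP; first exact: (subsetP sNM).
  apply: coset_id; apply/layer_relP; exists (fun c => if c == 1 then x else 1), (fun=> 1).
  split=> // [c|c]; first by case: ifP => // _; apply: (subsetP sNM).
  by rewrite !morph1 mulgV; case: ifP => _; rewrite ?morph1 ?coset_id.
- exact: layer_map_rel.
Qed.
End Layer.

(** * Free groups are residually p *)

Definition spow (gT : finGroupType) (g : gT) (n : nat) (b : bool) : gT :=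
  if b then g ^+ n else g ^- n.

(* Both words and block words are read from the right: the head is the last factor. *)
Fixpoint word_eval (X : Type) (C : finGroupType) (d : X -> C) (u : seq (X * bool)) : C :=
  if u is (x, b) :: u' then word_eval d u' * spow (d x) 1 b else 1.

Fixpoint block_eval (X : Type) (C : finGroupType) (d : X -> C)
    (u : seq (X * nat * bool)) : C :=
  if u is (x, n, b) :: u' then block_eval d u' * spow (d x) n b else 1.

Lemma spow1g (gT : finGroupType) n b : spow (1 : gT) n b = 1.
Proof. by case: b; rewrite /spow ?expg1n ?invg1. Qed.

Lemma spowS (gT : finGroupType) (g : gT) n b : spow g n.+1 b = spow g n b * spow g 1 b.
Proof. by case: b; rewrite /spow expg1 -?invMg -?expgS -?expgSr. Qed.

Lemma spow_expg_eq1 (gT : finGroupType) (g : gT) n b m :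
  spow g n b ^+ m = 1 -> g ^+ (n * m) = 1.
Proof.
by case: b; rewrite /spow expgM // expgVn => /eqP; rewrite invg_eq1 => /eqP.
Qed.

(** * Counting blocks by iterated wreath products *)

Section Cascade.
Variables (X : eqType) (Z C : finGroupType) (d : X -> C) (v : C -> Z) (x : X).
Hypothesis vd : forall c, v (c * d x) = v c.

(** The letter [x] multiplies the [Z]-coordinate by [v] of the current position; the other letters
    leave it alone. Since [v] is invariant under [d x], a block of [n] letters [x] contributes an
    [n]-th power. *)
Definition cascade y := wrp (fun c => if y == x then v c else 1) (d y).

Lemma cascade_spow y n b g c :
  spow (cascade y) n b (g, c) = (g * spow (if y == x then v c else 1) n b, c * spow (d y) n b).
Proof.
have vd' c' : v (c' * (d x)^-1) = v c' by rewrite -vd mulgKV.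
have vX m c' : v (c' * spow (d x) m b) = v c'.
  elim: m => [|m IH]; first by case: (b); rewrite /spow ?invg1 mulg1.
  by rewrite (spowS _ m) mulgA; case: (b) IH => IH; rewrite /spow /= expg1 ?vd ?vd' IH.
elim: n => [|n IH]; first by case: (b); rewrite /spow ?invg1 perm1 !mulg1.
rewrite !(spowS _ n) permM IH !mulgA.
case: eqP => [->|neq]; last first.
  case: (b); rewrite /spow /= !expg1 ?wrpV wrpE ?eqxx; have /eqP/negPf-> := neq;
  by rewrite ?invg1.
by case: (b) vX => vX; rewrite /spow /= !expg1 ?wrpV wrpE eqxx ?vX // vd' vX.
Qed.

Lemma cascade_block_eval u :
  (forall k, (0 < k <= size u)%N -> v (block_eval d (drop k u)) = 1) ->
  block_eval cascade u (1, 1) = (1, block_eval d u).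
Proof.
elim: u => [|[[y n] b] u IH] H; first by rewrite perm1.
rewrite /= permM IH => [|k /andP[k_gt0 le_k]]; last by apply: (H k.+1).
rewrite cascade_spow mul1g; have := H 1%N isT; rewrite /= drop0 => ->.
by rewrite if_same spow1g.
Qed.
End Cascade.

(** Induction on the blocks: the next block [x] differs from the previous letter, so [v] is
    invariant under [d x] and the cascade applies; the new [v] reads the [Z]-coordinate reached from
    [(1, 1)]. It is trivial on proper tails and raises the old value to the power plus or minus [n].
    The last clause is phrased by powers being trivial so that signs need no tracking. *)
Lemma block_separation p (X : eqType) (Z : finGroupType) (z : Z) (u : seq (X * nat * bool)) :
  p.-group [set: Z] -> sorted (fun b b' => b.1.1 != b'.1.1) u ->
  exists (C : finGroupType) (K : {group C}) (d : X -> C) (v : C -> Z),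
  [/\ p.-group K, forall x, d x \in K,
      forall c y, (if u is b :: _ then y != b.1.1 else true) -> v (c * d y) = v c,
      forall k, (0 < k <= size u)%N -> v (block_eval d (drop k u)) = 1
    & forall m, v (block_eval d u) ^+ m = 1 -> z ^+ (\prod_(b <- u) b.1.2 * m) = 1].
Proof.
move=> pZ; elim: u => [|[[x n] b] u IH] red.
  exists Z, [1]%G, (fun=> 1), (fun=> z); split=> //; first exact: pgroup1.
  - by case.
  - by move=> m; rewrite big_nil mul1n.
have {IH}[|C [K [d [v [pK dK vd vt vz]]]]] := IH; first exact: path_sorted red.
have vdx c : v (c * d x) = v c.
  by apply: vd; move: red; case: (u) => // b' u' /andP[].
have tails k : block_eval (cascade d v x) (drop k u) (1, 1) = (1, block_eval d (drop k u)).
  apply: cascade_block_eval => // j /andP[j_gt0]; rewrite size_drop => le_j.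
  rewrite drop_drop; apply: vt; rewrite addn_gt0 j_gt0 /=.
  have ltk : (k < size u)%N by rewrite -subn_gt0 (leq_trans j_gt0).
  by rewrite addnC -leq_subRL // ltnW.
exists _, (wreath [set: Z] K)%G, (cascade d v x), (fun y : {perm Z * C} => (y (1, 1)).1); split.
- exact: wreath_pgroup.
- by move=> y; apply: wrp_wreath => // q; rewrite inE.
- by move=> y x' /= neq; rewrite permM; case: (y (1, 1)) => g c; rewrite wrpE (negPf neq) /= mulg1.
- by case=> // k _ /=; rewrite tails.
- move=> m; rewrite /= permM; have := tails 0; rewrite drop0 => ->.
  rewrite cascade_spow // eqxx mul1g /= => /spow_expg_eq1/vz.
  by rewrite big_cons /= mulnA [(_ * n)%N]mulnC.
Qed.

Fixpoint blocks (X : eqType) (u : seq (X * bool)) : seq (X * nat * bool) :=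
  if u is (x, b) :: u' then
    if blocks u' is (x', n, b') :: w then
      if x == x' then (x, n.+1, b) :: w else (x, 1%N, b) :: (x', n, b') :: w
    else [:: (x, 1%N, b)]
  else [::].

Definition no_cancel (X : eqType) (l l' : X * bool) := (l.1 == l'.1) ==> (l.2 == l'.2).

(** Equal neighbours in a reduced word carry the same sign, so each run merges into one power of
    positive exponent. *)
Lemma blocksP (X : eqType) (u : seq (X * bool)) : sorted (@no_cancel X) u ->
  [/\ sorted (fun b b' => b.1.1 != b'.1.1) (blocks u), all (fun b => 0 < b.1.2)%N (blocks u),
      (if u is (x, b) :: _ then exists n w, blocks u = (x, n, b) :: w else blocks u = [::])
    & forall (C : finGroupType) (d : X -> C), block_eval d (blocks u) = word_eval d u].
Proof.
elim: u => [|[x b] u IH] red //; have {IH} [srt pos hd ev] := IH (path_sorted red).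
move: u red srt pos hd ev => [|[x' b'] u] /=.
  by move=> *; split=> //; exists 1%N, [::].
move=> /andP[nc _] + + [n [w Ebl]]; rewrite Ebl => srt pos ev.
case: eqP => [Ex|/eqP nx].
  subst x'; move: nc ev; rewrite /no_cancel eqxx /= => /eqP <- ev; split.
  - by case: (w) srt.
  - by case/andP: pos.
  - by exists n.+1, w.
  by move=> C d /=; rewrite (spowS _ n) mulgA -ev /=.
split=> //; [by rewrite /= nx | by exists 1%N; eexists | by move=> C d /=; rewrite -ev].
Qed.

Lemma exists_cyclic_pgroup (p k : nat) : prime p ->
  exists (Z : finGroupType) (z : Z), p.-group [set: Z] /\ #[z] = (p ^ k)%N.
Proof.
move=> p_pr; have q_gt0 : (0 < p ^ k)%N by rewrite expn_gt0 prime_gt0.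
exists 'I_(p ^ k).-1.+1, Zp1; split; last by rewrite order_Zp1 prednK.
by rewrite /pgroup cardsT card_ord prednK // pnatX pnat_id.
Qed.

(* Magnus-type argument: for the word written as a product of powers of letters,
   adjacent ones distinct, the cascade computes the product of the exponents. *)
Lemma free_residually_p (p : nat) (X : eqType) (u : seq (X * bool)) : prime p ->
  u != [::] -> sorted (@no_cancel X) u ->
  exists (C : finGroupType) (K : {group C}) (d : X -> C),
    [/\ p.-group K, forall x, d x \in K & word_eval d u != 1].
Proof.
move=> p_pr u0 /blocksP[srt pos hd ev].
have bl0 : (0 < size (blocks u))%N by move: u0 hd; case: (u) => // -[x b] ? _ [n [w ->]].
set N := (\prod_(b <- blocks u) b.1.2)%N.
have N_gt0 : (0 < N)%N.
  rewrite /N; elim: (blocks u) pos => [|b w IH] /=; first by rewrite big_nil.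
  by case/andP=> b_gt0 /IH; rewrite big_cons muln_gt0 b_gt0.
(* The order [p ^ N] exceeds [N], so [z ^+ N] is non-trivial; a trivial word would have the value
   [v 1 = 1] of the empty tail and force [z ^+ N = 1]. *)
have [Z [z [pZ oz]]] := exists_cyclic_pgroup N p_pr.
have [C [K [d [v [pK dK _ vt vz]]]]] := block_separation z pZ srt.
exists C, K, d; split=> //; apply/eqP; rewrite -ev => E.
have v1 : v 1 = 1 by have := vt (size (blocks u)); rewrite drop_size bl0 leqnn; apply.
have := vz 1%N; rewrite E v1 expg1n muln1 => /(_ erefl)/eqP.
rewrite -order_dvdn oz => /(dvdn_leq N_gt0); rewrite leqNgt ltn_expl //.
exact: prime_gt1.
Qed.

(** * Words in the HNN extension *)

Section HnnWords.
Variables (gT : finGroupType) (G A B : {group gT}) (phi : {morphism A >-> gT}).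
Hypotheses (sAG : A \subset G) (sBG : B \subset G) (phiAB : phi @* A = B).

Notation "u ~ v" := (hnn_equiv G A phi u v) (at level 70).

Lemma hnn_equiv_ctx pre suf u v : u ~ v -> pre ++ u ++ suf ~ pre ++ v ++ suf.
Proof.
elim=> {u v} [u v [l [r [x [y [lr -> ->]]]]]|u|u v _|u v w _ uv _].
- apply: rst_step; exists l, r, (pre ++ x), (y ++ suf).
  by split; rewrite // !catA.
- exact: rst_refl.
- exact: rst_sym.
- exact: rst_trans uv.
Qed.

Lemma hnn_equiv_rule pre suf l r : hnn_rule G A phi l r -> pre ++ l ++ suf ~ pre ++ r ++ suf.
Proof. by move=> lr; apply: rst_step; exists l, r, pre, suf. Qed.

Lemma hnn_equiv_trans v u w : u ~ v -> v ~ w -> u ~ w.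
Proof. exact: rst_trans. Qed.

Lemma hnn_equiv_sym u v : u ~ v -> v ~ u.
Proof. exact: rst_sym. Qed.

Definition stable (b : bool) : hnn_letter gT := if b then Lt else Lti.
(** The elements that [stable b] and its inverse conjugate back into [G]: [t B t^-1 = A] and
    [t^-1 A t = B]. *)
Definition assoc_sub (b : bool) : {group gT} := if b then B else A.

Lemma hnn_pinch b g : g \in assoc_sub b ->
  exists2 a, a \in G & forall w, [:: stable b, Lg g, stable (~~ b) & w] ~ Lg a :: w.
Proof.
case: b => /= gS; last first.
  exists (phi g) => [|w]; last exact: (hnn_equiv_rule [::] w (rule_conj G phi gS)).
  by apply: (subsetP sBG); rewrite -phiAB mem_morphim.
move: gS; rewrite -phiAB => /morphimP[a aA _ ->]; exists a; first exact: (subsetP sAG).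
move=> w; apply: (@hnn_equiv_trans [:: Lt, Lti, Lg a, Lt, Lti & w]).
  apply: hnn_equiv_sym; exact: (hnn_equiv_rule [:: Lt] (Lti :: w) (rule_conj G phi aA)).
apply: (@hnn_equiv_trans [:: Lg a, Lt, Lti & w]).
  exact: (hnn_equiv_rule [::] [:: Lg a, Lt, Lti & w] (rule_tti G A phi)).
exact: (hnn_equiv_rule [:: Lg a] w (rule_tti G A phi)).
Qed.

Definition normal_word (g : gT) (s : seq (bool * gT)) : hnn_word gT :=
  Lg g :: flatten [seq [:: stable u.1; Lg u.2] | u <- s].

Definition no_pinch (u v : bool * gT) := (u.1 != v.1) ==> (u.2 \notin assoc_sub u.1).

(** The word is built from the right. A new stable letter can pinch only with the first one of the
    reduced tail, and removing that pinch leaves a shorter reduced tail. *)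
Lemma hnn_reduce w : all (letter_in G) w ->
  exists g s, [/\ g \in G, all (fun u => u.2 \in G) s, sorted no_pinch s
                & w ~ normal_word g s].
Proof.
have stable_step b g s : g \in G -> all (fun u => u.2 \in G) s -> sorted no_pinch s ->
  exists g' s', [/\ g' \in G, all (fun u => u.2 \in G) s', sorted no_pinch s'
                & stable b :: normal_word g s ~ normal_word g' s'].
- move=> gG sG red.
  have push : path no_pinch (b, g) s -> exists g' s',
      [/\ g' \in G, all (fun u => u.2 \in G) s', sorted no_pinch s'
        & stable b :: normal_word g s ~ normal_word g' s'].
    move=> pth; exists 1, ((b, g) :: s); split=> //=; first by rewrite gG.
    by apply/hnn_equiv_sym/(hnn_equiv_rule [::] (stable b :: normal_word g s) (rule_one G A phi)).
  case: s sG red push => [|[b' h] s] sG red push; first exact: push.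
  case npi: (no_pinch (b, g) (b', h)); first by apply: push; rewrite /= npi.
  move: npi; rewrite /no_pinch /= => /negbT; rewrite negb_imply negbK => /andP[nb gS].
  have {nb} -> : b' = ~~ b by case: (b) nb; case: (b').
  have [a aG Ea] := hnn_pinch gS; case/andP: sG => /= hG sG.
  exists (a * h), s; split=> //; [exact: groupM | exact: path_sorted red |].
  apply: hnn_equiv_trans (Ea _) _.
  exact: (hnn_equiv_rule [::] _ (rule_mul A phi aG hG)).
elim: w => [|l w IH] /=.
  exists 1, [::]; split=> //; apply: hnn_equiv_sym.
  exact: (hnn_equiv_rule [::] [::] (rule_one G A phi)).
case/andP=> lG /IH[g [s [gG sG red Ew]]].
have {}Ew : l :: w ~ l :: normal_word g s.
  by have := hnn_equiv_ctx [:: l] [::] Ew; rewrite !cats0.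
case: l lG Ew => [x||] /= lG Ew.
- exists (x * g), s; split=> //; first exact: groupM.
  apply: hnn_equiv_trans Ew _; exact: (hnn_equiv_rule [::] _ (rule_mul A phi lG gG)).
- have [g' [s' [? ? ? E]]] := stable_step true g s gG sG red.
  by exists g', s'; split=> //; apply: hnn_equiv_trans E.
- have [g' [s' [? ? ? E]]] := stable_step false g s gG sG red.
  by exists g', s'; split=> //; apply: hnn_equiv_trans E.
Qed.

Section Eval.
Variables (P : finGroupType) (f : {morphism G >-> P}) (t : P).
Hypothesis ft : forall a, a \in A -> f a * t = t * f (phi a).

Lemma hnn_eval_cat u v : hnn_eval f t (u ++ v) = hnn_eval f t u * hnn_eval f t v.
Proof. by elim: u => [|l u IH] /=; rewrite ?mul1g // IH mulgA. Qed.

Lemma hnn_eval_equiv u v : u ~ v -> hnn_eval f t u = hnn_eval f t v.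
Proof.
elim=> {u v} [u v [l [r [x [y [lr -> ->]]]]]|u|u v _|u v w _ -> _] //.
rewrite !hnn_eval_cat; congr (_ * (_ * _)); case: lr => [g h gG hG||||a aA] /=.
- by rewrite morphM // !mulg1.
- by rewrite morph1 mulg1.
- by rewrite mulg1 mulgV.
- by rewrite mulg1 mulVg.
- by rewrite !mulg1 ft // mulKg.
Qed.
End Eval.

(** * Separating reduced words by paths labelled with cosets *)

Section Separate.
Variables (P : finGroupType) (K : {group P}) (f : {morphism G >-> P}) (t : P).
Hypotheses (fK : f @* G \subset K) (tK : t \in K) (injf : 'ker f = 1).
Hypothesis ft : forall a, a \in A -> f a * t = t * f (phi a).

(** The path of a word in the graph on [P] with an edge from [q] to [q * t], labelled by the left
    coset of [q]. A letter [t^-1] runs backwards along the edge that starts at [q * t^-1]. *)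
Fixpoint edge_word (q : P) (s : seq (bool * gT)) : seq ({set P} * bool) :=
  if s is (b, g) :: s' then
    let r := if b then q else q * t^-1 in
    (r *: (f @* A), b) :: edge_word (q * spow t 1 b * f g) s'
  else [::].

(** If an edge label were followed by its inverse, the coset equality would put [f g] in [f @* A],
    or [t * f g * t^-1] in it; as [f] is injective, [g] would then create a pinch. *)
Lemma edge_word_no_cancel q s : all (fun u => u.2 \in G) s -> sorted no_pinch s ->
  sorted (@no_cancel _) (edge_word q s).
Proof.
have finj : 'injm f by rewrite injf.
elim: s q => [|[b g] s IH] q //= /andP[gG sG] red.
have {IH} := IH (q * spow t 1 b * f g) sG (path_sorted red).
case: s sG red => [|[b' h] s] //= _ /andP[np _] ->; rewrite andbT /no_cancel /=.
apply/implyP=> /eqP E; apply: contraT => nb; move: np; rewrite /no_pinch /= nb /=.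
suff -> : g \in assoc_sub b by [].
have fAP x : x \in G -> f x \in f @* A -> x \in A.
  move=> xG /morphimP[a aG aA /(injmP finj)]; by move=> ->.
case: b b' nb E => -[] //= _; rewrite /spow expg1 => /lcoset_eqP; rewrite mem_lcoset.
  case/morphimP=> a aG aA Ea; rewrite -phiAB.
  have -> : g = phi a^-1; last by rewrite mem_morphim ?groupV.
  have paG : phi a^-1 \in G.
    by apply: (subsetP sBG); rewrite -phiAB mem_morphim ?groupV.
  apply: (injmP finj) => //; apply: (mulgI t); rewrite -ft ?groupV // morphV //.
  by rewrite -Ea invMg invgK !mulgA mulVg mul1g mulgKV.
by rewrite invMg mulgKV groupV; apply: fAP.
Qed.

Section Rep.
Variables (C : finGroupType) (KC : {group C}) (d : {set P} -> C).

Definition sep_map g : {perm C * P} := wrp (fun=> 1) (f g).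
(** The function twisting [t] is constant on left cosets of [f @* A]; hence moving by [f a] does not
    change it and the defining relations survive. *)
Definition sep_stable : {perm C * P} := wrp (fun q => d (q *: (f @* A))) t.

Lemma sep_mapM : {in G &, {morph sep_map : x y / x * y}}.
Proof.
by move=> x y xG yG; rewrite /sep_map wrpM morphM //; apply: eq_wrp => q; rewrite mulg1.
Qed.
Canonical sep_morphism := Morphism sep_mapM.

Lemma sep_stable_conj a : a \in A -> sep_map a * sep_stable = sep_stable * sep_map (phi a).
Proof.
move=> aA; rewrite !wrpM ft //; apply: eq_wrp => q; rewrite mul1g mulg1 lcosetM.
by rewrite lcoset_id // mem_morphim // (subsetP sAG).
Qed.

Lemma sep_stable_spow b c q : spow sep_stable 1 b (c, q) =
  (c * spow (d ((if b then q else q * t^-1) *: (f @* A))) 1 b, q * spow t 1 b).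
Proof. by case: b; rewrite /spow /= !expg1 ?wrpV wrpE. Qed.

(** The first coordinate collects the labels along the path. The list is reversed because
    [word_eval] takes its head as the last factor. *)
Lemma sep_eval g s c q : (hnn_eval sep_map sep_stable (normal_word g s) (c, q)).1
  = c * word_eval d (rev (edge_word (q * f g) s)).
Proof.
rewrite /= permM wrpE mulg1; elim: s c (q * f g) => [|[b h] s IH] c r.
  by rewrite /= perm1 mulg1.
have -> : hnn_eval sep_map sep_stable (flatten [seq [:: stable u.1; Lg u.2] | u <- (b, h) :: s])
    = spow sep_stable 1 b * (sep_map h *
        hnn_eval sep_map sep_stable (flatten [seq [:: stable u.1; Lg u.2] | u <- s])).
  by case: b.
rewrite permM sep_stable_spow permM wrpE mulg1 IH -mulgA; congr (_ * _).
rewrite /= rev_cons -cats1; elim: (rev _) => [|[x b'] v IHv] /=; first by rewrite mul1g mulg1.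
by rewrite mulgA IHv.
Qed.

Lemma sep_map_mem g : g \in G -> sep_map g \in wreath KC K.
Proof.
by move=> gG; apply: wrp_wreath => [q|]; rewrite ?group1 // (subsetP fK) ?mem_morphim.
Qed.

Lemma sep_stable_mem : (forall x, d x \in KC) -> sep_stable \in wreath KC K.
Proof. by move=> dK; apply: wrp_wreath. Qed.

End Rep.
End Separate.

(** Passes from a p-subgroup [K] to the type [subg_of K], since the target of the required
    homomorphism is a whole type. *)
Lemma hnn_residually_p_of_subgroup (p : nat) w : all (letter_in G) w ->
  (exists (P : finGroupType) (K : {group P}) (f : {morphism G >-> P}) (t : P),
    [/\ p.-group K, f @* G \subset K, t \in K,
        forall a, a \in A -> f a * t = t * f (phi a) & hnn_eval f t w != 1]) ->
  exists (P : finGroupType) (f : {morphism G >-> P}) (t : P),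
    [/\ p.-group [set: P],
        forall a, a \in A -> t^-1 * f a * t = f (phi a)
      & hnn_eval f t w != 1].
Proof.
move=> wG [P [K [f [t [pK fK tK ft ev]]]]].
have fgK g : g \in G -> f g \in K by move=> gG; rewrite (subsetP fK) ?mem_morphim.
have fM : {in G &, {morph (fun g => subg K (f g)) : x y / x * y}}.
  by move=> x y xG yG; rewrite /= morphM // morphM ?fgK.
exists (subg_of K : finGroupType), (Morphism fM), (subg K t); split.
- by rewrite /pgroup cardsT card_sub.
- move=> a aA /=; have aG := subsetP sAG a aA.
  have paG : phi a \in G by apply: (subsetP sBG); rewrite -phiAB mem_morphim.
  apply: (mulgI (subg K t)); rewrite !mulgA mulgV mul1g.
  by rewrite -!subgM ?fgK // ft.
- apply: contra ev => /eqP/(congr1 sgval) E; rewrite -[_ == _]/(_ == sgval (1 : [subg K])) -E.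
  apply/eqP; elim: w wG {E} => [|l w IH] //= /andP[lG /IH->].
  by case: l lG => [x||] lG; rewrite /= subgK ?fgK.
Qed.

Lemma hnn_residually_p_of_realizable (p : nat) : prime p ->
  p_realizable p G A phi 1 -> hnn_residually_p p G A phi.
Proof.
move=> p_pr [P [K [f [t [pK fK tK kf ft]]]]] w wG w_neq1.
apply: hnn_residually_p_of_subgroup => //.
have [g [s [gG sG red Ew]]] := hnn_reduce wG.
case: s => [|u s] in sG red Ew *.
  (* Without stable letters the word is a single element of [G], and the injective [f] already
     detects it. *)
  exists P, K, f, t; split=> //; rewrite (hnn_eval_equiv ft Ew) /= mulg1.
  apply: contra_notN w_neq1 => /eqP fg.
  have /set1P g1 : g \in [1] by rewrite -kf; apply/kerP.
  apply: hnn_equiv_trans Ew _; rewrite g1.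
  exact: (hnn_equiv_rule [::] [::] (rule_one G A phi)).
(* Otherwise the path gives a non-empty reduced word in the free group on the cosets, and a
   p-quotient of that group where it survives provides the twist [d]. *)
have nc := edge_word_no_cancel kf ft (f g) sG red.
have [||C [KC [d [pC dK ev]]]] := @free_residually_p p _ (rev (edge_word f t (f g) (u :: s))) p_pr.
- by rewrite -size_eq0 size_rev; case: (u).
- by rewrite rev_sorted; apply: sub_sorted nc => x y; rewrite /no_cancel eq_sym [x.2 == _]eq_sym.
have rel := sep_stable_conj ft d.
exists _, (wreath KC K)%G, (sep_morphism f C), (sep_stable f t d); split=> //.
- exact: wreath_pgroup.
- by apply/subsetP=> _ /morphimP[x _ xG ->]; apply: sep_map_mem.
- exact: sep_stable_mem.
rewrite (hnn_eval_equiv rel Ew); apply: contra ev => /eqP E.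
by have := sep_eval f t d g (u :: s) 1 1; rewrite mul1g E perm1 /= mul1g => <-.
Qed.
End HnnWords.

(** * Induction along the filtration *)

Theorem theorem1p5 (p : nat) (gT : finGroupType) (G A B : {group gT})
    (phi : {morphism A >-> gT}) (n : nat) (Gs : nat -> {group gT}) :
  prime p -> p.-group G ->
  A \subset G -> B \subset G -> 'injm phi -> phi @* A = B ->
  (* (Gs 1, ..., Gs n) is a filtration of G, with Gs i = 1 for i > n *)
  (0 < n)%N -> Gs 1%N = G -> Gs n :=: 1 ->
  (forall i, (n < i)%N -> Gs i :=: 1) ->
  (forall i, (1 <= i < n)%N -> Gs i.+1 \proper Gs i) ->
  (forall i, (1 <= i <= n)%N -> Gs i <| G) ->
  (* central *)
  (forall i, (1 <= i < n)%N -> Gs i / Gs i.+1 \subset 'Z(G / Gs i.+1)) ->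
  (* compatible with (G, phi) *)
  (forall i, (1 <= i <= n)%N -> phi @* (A :&: Gs i) = B :&: Gs i) ->
  (* the automorphism of the core H(G_i/G_{i+1}, phi_{i,i+1}) has p-power order *)
  (forall i, (1 <= i <= n)%N ->
     exists e : nat, forall x,
       in_core ((A :&: Gs i) / Gs i.+1) ((B :&: Gs i) / Gs i.+1)
               (induced_phi A phi (Gs i) (Gs i.+1)) x ->
       iter (p ^ e) (induced_phi A phi (Gs i) (Gs i.+1)) x = x) ->
  hnn_residually_p p G A phi.
Proof.
move=> p_pr pG sAG sBG injphi phiAB n_gt0 Gs1 Gsn _ prop nrm cent compat core.
apply: (hnn_residually_p_of_realizable sAG sBG phiAB p_pr); rewrite -Gsn.
suffices H i : (i < n)%N -> p_realizable p G A phi (Gs i.+1).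
  by rewrite -(prednK n_gt0); apply: H; rewrite prednK.
elim: i => [_|i IH lt_in].
  (* The induction starts from [G / Gs 1], which is trivial. *)
  exists gT, [1]%G, (triv_morph gT G), 1; split=> //.
  - exact: pgroup1.
  - by apply/subsetP=> _ /morphimP[x _ _ ->]; rewrite inE.
  - by rewrite Gs1 ker_trivm.
have in1 : (1 <= i.+1 < n)%N by [].
have in2 : (1 <= i.+1 <= n)%N by apply: ltnW.
have in3 : (1 <= i.+2 <= n)%N by [].
have /andP[sMG nMG] := nrm _ in2; have /andP[sNG nNG] := nrm _ in3.
have sNM := proper_sub (prop _ in1); have nNM := subset_trans sMG nNG.
have cGM : [~: G, Gs i.+1] \subset Gs i.+2.
  rewrite commGC -quotient_cents2 //; apply: subset_trans (cent _ in1) _.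
  exact: subsetIr.
apply: (p_realizable_step sAG _ cGM); first by rewrite phiAB.
  exact: IH (ltnW lt_in).
have [e core_e] := core _ in2.
(* The exponent is at least [e], so the [p ^ k]-th iterate fixes the core, and at least the number
   of cosets, so [p ^ k] exceeds that number as the pigeonhole argument requires. *)
have [Z [z [_ oz]]] := exists_cyclic_pgroup (e + #|{: coset_of (Gs i.+2)}|) p_pr.
apply: (layer_realizable injphi sNM nNM _ (compat _ in2) (compat _ in3) _ oz p_pr _ _ core_e).
- apply: abelianS (cent _ in1) (center_abelian _).
- exact: pgroupS sMG pG.
- exact: leq_addr.
- apply: leq_ltn_trans (leq_addl e _) (ltn_expl _ (prime_gt1 p_pr)).
Qed.
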